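(* Let $\omega\in\mathbb{R}^{\mathbb{N}}$ and let $\Phi_\omega$ be the associated Kronecker flow on the infinite torus $\mathbb{T}^{\mathbb{N}}$. Then the closure of any orbit of $\Phi_\omega$ is homeomorphic to $\mathscr{M}_\omega^*$, the Pontryagin dual of the frequency module $\mathscr{M}_\omega$ endowed with the discrete topology.
   Context: $\mathbb{N}=\{1,2,\dots\}$, $\mathbb{T}=\mathbb{R}/2\pi\mathbb{Z}$, and $\mathbb{T}^{\mathbb{N}}$ carries the product topology. The Kronecker flow is $\Phi_\omega^t(\theta)=(\Theta_j+\omega_jt+2\pi\mathbb{Z})_{j\in\mathbb{N}}$, where $\theta_j=\Theta_j+2\pi\mathbb{Z}$. $\mathbb{Z}^{(\mathbb{N})}$ is the group of finitely supported integer sequences, and $\mathscr{M}_\omega=\{\sum_j\omega_j\nu_j:\nu\in\mathbb{Z}^{(\mathbb{N})}\}\subset(\mathbb{R},+)$. The Pontryagin dual $G^*$ of a locally compact abelian group $G$ is the group of continuous homomorphisms $G\to\mathbb{T}$ with the compact-open topology. *)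

(* Defs.v *)
From HB Require Import structures.
From mathcomp Require Import all_boot all_order all_algebra generic_quotient.
From mathcomp Require Import all_classical all_reals all_analysis.

Set Implicit Arguments.
Unset Strict Implicit.
Unset Printing Implicit Defensive.

Import Order.TTheory GRing.Theory Num.Theory.
Import numFieldNormedType.Exports.

Local Open Scope classical_set_scope.
Local Open Scope ring_scope.
Local Open Scope quotient_scope.

Definition homeomorphic (X Y : topologicalType) : Prop :=
  exists (f : X -> Y) (g : Y -> X),
    [/\ continuous f, continuous g, cancel f g & cancel g f].

Definition two_pi_Z (R : realType) : {pred R} :=
  fun x => `[< exists k : int, x = k%:~R * (2 * pi) >].
Arguments two_pi_Z R : clear implicits.

Section two_pi_Z_closed.
Variable R : realType.

Lemma two_pi_ZP (x : R) :
  reflect (exists k : int, x = k%:~R * (2 * pi)) (x \in two_pi_Z R).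
Proof. exact: asboolP. Qed.

Fact two_pi_Z_zmod_closed : zmod_closed (two_pi_Z R).
Proof.
split; first by apply/two_pi_ZP; exists 0; rewrite mul0r.
move=> x y /two_pi_ZP[k ->] /two_pi_ZP[l ->]; apply/two_pi_ZP.
by exists (k - l); rewrite rmorphB mulrBl.
Qed.

HB.instance Definition _ :=
  GRing.isZmodClosed.Build R (two_pi_Z R) two_pi_Z_zmod_closed.
End two_pi_Z_closed.

Definition circle (R : realType) : Type :=
  quotient_topology (Quotient.quot (two_pi_Z R)).

HB.instance Definition _ (R : realType) := Topological.on (circle R).
HB.instance Definition _ (R : realType) := Quotient.on (circle R).
HB.instance Definition _ (R : realType) := GRing.isZmodule.Build (circle R)
  (@Quotient.addqA _ (two_pi_Z R)) (@Quotient.addqC _ (two_pi_Z R))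
  (@Quotient.add0q _ (two_pi_Z R)) (@Quotient.addNq _ (two_pi_Z R)).

Section circle_theory.
Variable R : realType.

Lemma eq_circle (x y : R) :
  \pi_(circle R) x = \pi_(circle R) y <-> exists k : int, x - y = k%:~R * (2 * pi).
Proof.
split=> [xy|/two_pi_ZP xy].
  by apply/two_pi_ZP; rewrite (@Quotient.idealrBE _ (two_pi_Z R)); apply/eqP.
by move: xy; rewrite (@Quotient.idealrBE _ (two_pi_Z R)) => /eqP.
Qed.

Lemma circle_piD (x y : R) :
  \pi_(circle R) (x + y) = \pi_(circle R) x + \pi_(circle R) y.
Proof. exact: (@Quotient.pi_add _ (two_pi_Z R)). Qed.

Lemma circle_pi_continuous : continuous (\pi_(circle R) : R -> circle R).
Proof. exact: pi_continuous. Qed.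
End circle_theory.

(* The index set {1, 2, ...} is relabelled by nat, through j |-> j - 1. *)
Definition infinite_torus (R : realType) : topologicalType :=
  {ptws nat -> circle R}.

Definition kronecker_flow (R : realType) (omega : nat -> R) (t : R)
    (theta : infinite_torus R) : infinite_torus R :=
  fun j => \pi_(circle R) (repr (theta j) + omega j * t).

(* The value of the flow does not depend on the representatives. *)
Lemma kronecker_flow_pi (R : realType) (omega : nat -> R) (t : R)
    (Theta : nat -> R) :
  kronecker_flow omega t (fun j => \pi_(circle R) (Theta j)) =
  fun j => \pi_(circle R) (Theta j + omega j * t).
Proof.
by apply/funext => j; rewrite /kronecker_flow !circle_piD reprK.
Qed.

Definition kronecker_orbit (R : realType) (omega : nat -> R)
    (theta : infinite_torus R) : set (infinite_torus R) :=
  range (fun t => kronecker_flow omega t theta).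

Definition in_frequency_module (R : realType) (omega : nat -> R) : {pred R} :=
  fun x => `[< exists nu : nat -> int, finite_set [set j | nu j != 0] /\
                 x = \sum_(j \in [set: nat]) omega j * (nu j)%:~R >].

Section frequency_module_closed.
Variables (R : realType) (omega : nat -> R).

Lemma in_frequency_moduleP (x : R) :
  reflect (exists nu : nat -> int, finite_set [set j | nu j != 0] /\
             x = \sum_(j \in [set: nat]) omega j * (nu j)%:~R)
          (x \in in_frequency_module omega).
Proof. exact: asboolP. Qed.

Fact frequency_module_zmod_closed : zmod_closed (in_frequency_module omega).
Proof.
split.
  apply/in_frequency_moduleP; exists (fun=> 0); split.
    by apply: (sub_finite_set _ (finite_set0 nat)) => j.
  by rewrite fsbig1// => j _; rewrite mulr0.
move=> x y /in_frequency_moduleP[nu [fnu ->]] /in_frequency_moduleP[mu [fmu ->]].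
set D := [set j | nu j != 0] `|` [set j | mu j != 0].
have fD : finite_set D by rewrite finite_setU.
have sumD (la : nat -> int) : [set j | la j != 0] `<=` D ->
    \sum_(j \in [set: nat]) omega j * (la j)%:~R =
    \sum_(j \in D) omega j * (la j)%:~R.
  move=> laD; apply/esym/fsbig_widen => // j [_ Dj].
  have [laj|laj] := eqVneq (la j) 0; first by rewrite /= laj mulr0.
  by case: Dj; exact: laD.
have diffD : [set j | nu j - mu j != 0] `<=` D.
  move=> j /=; rewrite /D /=; have [->|nuj _] := eqVneq (nu j) 0; last by left.
  by rewrite sub0r oppr_eq0; right.
apply/in_frequency_moduleP; exists (fun j => nu j - mu j); split.
  exact: sub_finite_set fD.
rewrite (sumD nu); last by move=> j nuj; left.
rewrite (sumD mu); last by move=> j muj; right.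
rewrite (sumD (fun j => nu j - mu j))// -[X in _ + X]mulN1r mulr_fsumr.
rewrite -fsbig_split//=.
by apply: eq_fsbigr => j _; rewrite rmorphB/= mulrBr mulN1r.
Qed.

HB.instance Definition _ := GRing.isZmodClosed.Build R
  (in_frequency_module omega) frequency_module_zmod_closed.

Definition frequency_module : Type := {x : R | x \in in_frequency_module omega}.

HB.instance Definition _ := SubChoice.on frequency_module.
HB.instance Definition _ := [SubChoice_isSubZmodule of frequency_module by <:].
End frequency_module_closed.

Section discrete_zmodule.
Variable G : zmodType.
Let D := discrete_topology G.

HB.instance Definition _ := GRing.Zmodule.copy (discrete_topology G) G.

Fact discrete_sub_continuous : continuous (fun x : D * D => x.1 - x.2).
Proof.
move=> [x y] /= U /nbhs_singleton Uxy.
exists ([set x], [set y]); first by split; exact: discrete_set1.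
by move=> [_ _] [/= -> ->].
Qed.

HB.instance Definition _ :=
  PreTopologicalNmodule_isTopologicalZmodule.Build (discrete_topology G)
    discrete_sub_continuous.
End discrete_zmodule.

(* Coerced to a type, the dual carries the topology induced by the compact-open
   topology (library instance on set_type). *)
Definition pontryagin_dual (R : realType) (G : topologicalZmodType) :
    set {compact-open, G -> circle R} :=
  [set chi | continuous (chi : G -> circle R) /\
             zmod_morphism (chi : G -> circle R)].
Arguments pontryagin_dual R G : clear implicits.

(* Main.v *)
From HB Require Import structures.
Require Import Defs.
From mathcomp Require Import all_boot all_order all_algebra.
From mathcomp Require Import all_classical all_reals all_analysis.
From mathcomp Require Import complex ring lra.

(** Subtracting [theta] turns the orbit of [theta] into the one-parameter
    subgroup of the points [(omega_j t)_j] of the torus.  A point [z] of the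
    closure of the orbit satisfies, by continuity, every relation
    [\sum_j nu_j (z_j - theta_j) = 0] coming from an integral relation
    [\sum_j nu_j omega_j = 0] between the frequencies.  Hence
    [\sum_j nu_j omega_j |-> \sum_j nu_j (z_j - theta_j)] is a well-defined
    character of the frequency module ([orbit_closure_relation],
    [character_ofE]).  Conversely a character [chi] gives the point
    [(theta_j + chi omega_j)_j], and the two constructions are inverse to each
    other because the [omega_j] generate the module.  Both are continuous:
    compact subsets of a discrete group are finite, so that the compact-open
    topology of the dual is the topology of pointwise convergence, as is the
    topology of the torus.

    The substance is that the point given by a character lies in the closure of
    the orbit ([point_of_closure]).  This is the general form of Kronecker's
    approximation theorem ([kronecker_approximation]): if real numbers [c_j]
    satisfy modulo [2 pi] all integral relations between real numbers [a_j],
    then for suitable [t] all the [a_j t] are simultaneously as close as one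
    wishes to the [c_j] modulo [2 pi].

    Kronecker's theorem is proved by Bohr's method.  Put
    [f t = \sum_i e^(i (a_i t - c_i))], with [n] terms, one of which is the
    constant [1].  It suffices that [|f|] comes arbitrarily close to [n], for
    then all the terms almost agree with each other, and in particular with [1].
    Expand [f^p] over the words [w] of length [p]; the mean value of
    [|f|^(2p)] counts the pairs of words [(w, w')] whose frequencies cancel (the
    hypothesis on the [c_j] says that their phases cancel as well).  Words with
    the same letter counts are such pairs, and as there are at most [(p+1)^n]
    letter counts, the Cauchy-Schwarz inequality gives at least
    [n^(2p) / (p+1)^n] of them.  So if [|f|^2 <= B] everywhere then
    [n^(2p) <= (p+1)^n B^p] for all [p], which forces [n^2 <= B]
    ([card_le_sup_trig]). *)

Set Implicit Arguments.
Unset Strict Implicit.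
Unset Printing Implicit Defensive.

Import Order.TTheory GRing.Theory Num.Theory.
Import numFieldNormedType.Exports.

Local Open Scope classical_set_scope.
Local Open Scope ring_scope.
Local Open Scope quotient_scope.

(** * Mean values of trigonometric sums *)

Section trigonometric_sums.
Variable R : realType.

(** Multiplying by [2 sin (x / 2)] makes the sum of cosines telescope. *)
Lemma sum_cos_arith (x y : R) (K : nat) :
  2 * sin (x / 2) * \sum_(k < K) cos (x * k%:R + y) =
  sin (x * K%:R + y - x / 2) - sin (y - x / 2).
Proof.
elim: K => [|K IH]; first by rewrite big_ord0 !mulr0 add0r subrr.
rewrite big_ord_recr/= mulrDr {}IH.
have -> : x * K.+1%:R + y - x / 2 = (x * K%:R + y) + x / 2.
  by rewrite -natr1; field.
set u := x * K%:R + y; set v := x / 2.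
rewrite (sinD u v) (sinB u v); ring.
Qed.

Lemma sum_cos_arith_bounded (x y : R) (K : nat) : sin (x / 2) != 0 ->
  `|\sum_(k < K) cos (x * k%:R + y)| <= `|sin (x / 2)|^-1.
Proof.
move=> s0; have s_gt0 : 0 < `|sin (x / 2)| by rewrite normr_gt0.
rewrite -(ler_pM2l s_gt0) divff ?gt_eqF// -normrM.
have /eqP := sum_cos_arith x y K; rewrite -mulrA => /eqP E.
rewrite -(ler_pM2l (ltr0n R 2)) -[X in X * `|_|]ger0_norm// -normrM {}E.
rewrite mulr1 (le_trans (ler_normB _ _))// [leRHS](_ : _ = 1 + 1) ?lerD//;
  by rewrite ler_norml sin_le1 sin_geN1.
Qed.

Lemma sin_half_neq0 (x : R) : x != 0 -> `|x| <= 1 -> sin (x / 2) != 0.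
Proof.
wlog x0 : x / 0 < x => [H xn0 x1|_ x1].
  have [x0|x0] := ltP 0 x; first exact: H.
  rewrite -oppr_eq0 -sinN -mulNr H ?oppr_eq0 ?normrN//.
  by rewrite oppr_gt0 lt_neqAle xn0.
rewrite gt_eqF// sin2_gt0// divr_gt0//=.
by rewrite gtr0_norm// in x1; lra.
Qed.

(** The mean value over [t] of the trigonometric sum is the number of its terms of
    frequency zero, whose phases vanish modulo [2 pi].  The mean is taken over the
    multiples of a step [h], so small that no nonzero frequency is a multiple of
    [2 pi / h]: the sums of the other terms over these multiples then remain
    bounded. *)
Lemma card_zero_freq_le (P : finType) (lam gam : P -> R) (B : R) :
    (forall i, lam i = 0 -> cos (gam i) = 1) ->
    (forall t, \sum_i cos (lam i * t + gam i) <= B) ->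
  #|[pred i | lam i == 0]|%:R <= B.
Proof.
move=> lam0 leB; rewrite leNgt; apply/negP => ltB.
set N : R := _%:R in ltB.
pose S := \sum_i `|lam i|; pose h := (1 + S)^-1.
have S0 : 0 <= S by exact: sumr_ge0.
have h0 : 0 < h by rewrite invr_gt0 ltr_pwDl.
have lamh i : `|lam i * h| <= 1.
  rewrite normrM (gtr0_norm h0) ler_pdivrMr ?ltr_pwDl// mul1r /S (bigD1 i)//=.
  by rewrite addrCA lerDl addr_ge0 ?sumr_ge0.
pose E := \sum_(i | lam i != 0) `|sin (lam i * h / 2)|^-1.
have key K : K%:R * N - E <= K%:R * B.
  have : \sum_(k < K) \sum_i cos (lam i * (h * k%:R) + gam i) <= K%:R * B.
    rewrite [leRHS](_ : _ = \sum_(k < K) B) ?ler_sum//.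
    by rewrite sumr_const card_ord mulr_natl.
  apply: le_trans; rewrite exchange_big/= (bigID [pred i | lam i == 0])/=.
  apply: lerD.
    rewrite (eq_bigr (fun=> K%:R)) => [|i /eqP li0].
      by rewrite sumr_const -[leRHS]mulr_natr.
    rewrite (eq_bigr (fun=> 1)) => [|k _]; last by rewrite li0 mul0r add0r lam0.
    by rewrite sumr_const card_ord.
  rewrite -sumrN ler_sum// => i li0.
  under eq_bigr do rewrite mulrA.
  apply: lerNnormlW; apply: sum_cos_arith_bounded.
  by rewrite sin_half_neq0// mulf_neq0// gt_eqF.
(* Letting K tend to infinity in [key] contradicts [B < N]. *)
have NB : 0 < N - B by rewrite subr_gt0.
have E0 : 0 <= E / (N - B) by rewrite divr_ge0 ?(ltW NB)// sumr_ge0.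
have := archi_boundP E0; set K := Num.bound _.
rewrite ltr_pdivrMr// => EK; have := key K; rewrite leNgt => /negP; apply.
by rewrite mulrBr in EK; lra.
Qed.

Let cexp (x : R) : R[i] := (cos x +i* sin x)%C.

Let cexpD x y : cexp (x + y) = cexp x * cexp y.
Proof. by rewrite /cexp cosD sinD; congr (_ +i* _)%C; rewrite addrC. Qed.

Let cexp_sum (I : finType) (F : I -> R) :
  cexp (\sum_i F i) = \prod_i cexp (F i).
Proof. by apply: (big_morph cexp cexpD); rewrite /cexp cos0 sin0. Qed.

Let sum_cexp (I : finType) (F : I -> R) :
  \sum_i cexp (F i) = ((\sum_i cos (F i)) +i* (\sum_i sin (F i)))%C.
Proof.
elim: (index_enum I) => [|i r IH]; first by rewrite !big_nil.
by rewrite !big_cons IH.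
Qed.

(** This is the expansion of [|z|^2] as [z * conj z] for [z = \sum_i e^(i X_i)]. *)
Lemma sqr_trig_sumE (I : finType) (X : I -> R) :
  (\sum_i cos (X i)) ^+ 2 + (\sum_i sin (X i)) ^+ 2 =
  \sum_(ij : I * I) cos (X ij.1 - X ij.2).
Proof.
rewrite -(pair_bigA _ (fun i j => cos (X i - X j)))/=.
rewrite !expr2 !big_distrlr/= -big_split; apply: eq_bigr => i _ /=.
by rewrite -big_split; apply: eq_bigr => j _ /=; rewrite cosB.
Qed.

(** Both sides are the squared modulus of [(\sum_i e^(i x_i))^p], whose expansion
    by distributivity is indexed by the words of length [p]. *)
Lemma sqr_trig_sumX (I : finType) (x : I -> R) (p : nat) :
  ((\sum_i cos (x i)) ^+ 2 + (\sum_i sin (x i)) ^+ 2) ^+ p =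
  (\sum_(w : {ffun 'I_p -> I}) cos (\sum_i x (w i))) ^+ 2 +
  (\sum_(w : {ffun 'I_p -> I}) sin (\sum_i x (w i))) ^+ 2.
Proof.
pose nsq (z : R[i]) : R := let: (a +i* b)%C := z in a ^+ 2 + b ^+ 2.
have nsqM : {morph nsq : u v / u * v}.
  by move=> [a b] [c d]; rewrite /nsq/=; ring.
have nsqX z : nsq z ^+ p = nsq (z ^+ p).
  elim: p => [|p IH]; first by rewrite !expr0 /nsq/=; ring.
  by rewrite !exprS IH nsqM.
have -> : (\sum_i cos (x i)) ^+ 2 + (\sum_i sin (x i)) ^+ 2 =
          nsq (\sum_i cexp (x i)) by rewrite sum_cexp.
rewrite nsqX -[X in _ ^+ X]card_ord -prodr_const bigA_distr_bigA/=.
by under eq_bigr do rewrite -cexp_sum; rewrite sum_cexp.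
Qed.

End trigonometric_sums.

(** * Kronecker's approximation theorem *)

(** The left-hand side is the square of the sum of the cardinals of the [#|B|]
    fibres, the pairs on the right are counted by the sum of their squares. *)
Lemma cauchy_schwarz_fibers (A B : finType) (g : A -> B) :
  (#|A| ^ 2 <= #|B| * #|[pred u : A * A | g u.1 == g u.2]|)%N.
Proof.
pose x b := #|[pred a | g a == b]|.
have -> : #|A| = (\sum_b x b)%N.
  rewrite -sum1_card (partition_big g xpredT)//=; apply: eq_bigr => b _.
  by rewrite sum1_card.
have -> : #|[pred u : A * A | g u.1 == g u.2]| = (\sum_b x b ^ 2)%N.
  rewrite -sum1_card (partition_big (fun u => g u.1) xpredT)//=.
  apply: eq_bigr => b _; rewrite sum1_card expnS expn1 /x -cardX.
  apply: eq_card => -[a a']; rewrite !inE/=.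
  apply/andP/andP => -[/eqP ga /eqP ga']; first by rewrite -ga ga'.
  by rewrite inE/= ga ga'.
rewrite -(leq_pmul2l (isT : 0 < 2)%N).
have -> : ((\sum_b x b) ^ 2 = \sum_b \sum_c x b * x c)%N.
  by rewrite expnS expn1 big_distrlr.
rewrite big_distrr/=.
apply: (@leq_trans (\sum_b \sum_c (x b ^ 2 + x c ^ 2))%N).
  apply: leq_sum => b _; rewrite big_distrr/= leq_sum// => c _.
  exact: (nat_Cauchy _ _).1.
rewrite eq_leq//.
under eq_bigr do rewrite big_split/= sum_nat_const.
by rewrite big_split/= -big_distrr/= sum_nat_const -mulnDr addnn mulnCA mul2n.
Qed.

Lemma bernoulli (R : realType) (d : R) (n : nat) : 0 <= d ->
  1 + n%:R * d <= (1 + d) ^+ n.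
Proof.
move=> d0; elim: n => [|n IH]; first by rewrite mul0r addr0.
rewrite exprS -natr1.
have : (1 + d) * (1 + n%:R * d) <= (1 + d) * (1 + d) ^+ n.
  by rewrite ler_wpM2l// addr_ge0.
apply: le_trans; have : 0 <= n%:R * d * d by rewrite !mulr_ge0.
by lra.
Qed.

(** The powers of a ratio [A / B > 1] would outgrow every polynomial. *)
Lemma le_of_poly_growth (R : realType) (A B : R) (m : nat) : 0 <= B ->
  (forall p, A ^+ p <= p.+1%:R ^+ m * B ^+ p) -> A <= B.
Proof.
move=> B0 H; rewrite leNgt; apply/negP => BA.
have A0 : 0 < A by exact: le_lt_trans BA.
have {B0} B0 : 0 < B.
  rewrite lt_neqAle B0 andbT; apply: contraTneq (H 1%N) => <-.
  by rewrite !expr1 mulr0 -ltNge.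
pose d := A / B - 1.
have d0 : 0 < d by rewrite subr_gt0 ltr_pdivlMr// mul1r.
have {}H p : (1 + d) ^+ p <= p.+1%:R ^+ m.
  by rewrite addrCA subrr addr0 expr_div_n ler_pdivrMr ?exprn_gt0.
have C0 : 0 <= (2 * m.+1%:R + 1) / d ^+ 2.
  by rewrite divr_ge0 ?sqr_ge0// addr_ge0// mulr_ge0.
have := archi_boundP C0; move: (Num.bound _) => v.
rewrite ltr_pdivrMr ?exprn_gt0// => Hv.
have v1 : 1 <= v%:R :> R.
  rewrite (ler_nat R 1) lt0n; apply/eqP => v0; move: Hv.
  by rewrite v0 mul0r ltNge addr_ge0// mulr_ge0.
have d1_ge0 : 0 <= 1 + d by rewrite addr_ge0 ?(ltW d0).
have vd_ge0 : 0 <= v%:R * d by rewrite mulr_ge0 ?(ltW d0).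
(* With p = N, Bernoulli bounds (1 + d)^(2v) below by (v d)^2, which the choice of
   v makes at least N + 1; the (m+1)-st power of this exceeds (N + 1)^m. *)
pose N := (v * 2 * m.+1)%N.
have leN : N.+1%:R <= (1 + d) ^+ (v * 2).
  rewrite exprM; apply: (@le_trans _ _ ((v%:R * d) ^+ 2)).
    have : v%:R * (2 * m.+1%:R + 1) <= v%:R * (v%:R * d ^+ 2).
      by rewrite ler_wpM2l// ltW.
    have -> : N.+1%:R = v%:R * 2 * m.+1%:R + 1 :> R by rewrite -natr1 !natrM.
    by rewrite exprMn; lra.
  apply: lerXn2r; rewrite ?nnegrE ?exprn_ge0//.
  by apply: le_trans (bernoulli v (ltW d0)); rewrite lerDr.
have := H N; rewrite leNgt => /negP; apply.
apply: (@lt_le_trans _ _ (N.+1%:R ^+ m.+1)).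
  rewrite ltr_eXn2l// (ltr_nat R 1) ltnS !muln_gt0/= andbT.
  by rewrite -(ler_nat R) andbT.
by rewrite exprM; apply: lerXn2r; rewrite ?nnegrE ?exprn_ge0 ?ler0n.
Qed.

Lemma sum_word (R : realType) (I : finType) (x : I -> R) (p : nat)
    (w : {ffun 'I_p -> I}) :
  \sum_i x (w i) = \sum_j x j * #|[pred i | w i == j]|%:R.
Proof.
rewrite (partition_big w xpredT)//=; apply: eq_bigr => j _.
rewrite (eq_bigr (fun=> x j)) => [|i /eqP->//].
by rewrite sumr_const mulr_natr.
Qed.

Section kronecker.
Variables (R : realType) (I : finType) (a c : I -> R).

Let F (t : R) := (\sum_i cos (a i * t - c i)) ^+ 2 +
                 (\sum_i sin (a i * t - c i)) ^+ 2.

(* The sum is a multiple of [2 pi] exactly when its cosine is 1. *)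
Hypothesis H : forall nu : I -> int,
  \sum_i a i * (nu i)%:~R = 0 -> cos (\sum_i c i * (nu i)%:~R) = 1.

(** Bohr's argument: a bound for [F] bounds the mean value of [F^p], hence the
    number of pairs of words with the same letter counts, of which there are
    many. *)
Lemma card_le_sup_trig B : (forall t, F t <= B) -> #|I|%:R ^+ 2 <= B.
Proof.
move=> FB; have B0 : 0 <= B.
  by apply: le_trans (FB 0); rewrite addr_ge0 ?sqr_ge0.
apply: (@le_of_poly_growth _ _ _ #|I| B0) => p.
pose W := {ffun 'I_p -> I}.
pose lam (u : W * W) := \sum_i a (u.1 i) - \sum_i a (u.2 i).
pose gam (u : W * W) := - (\sum_i c (u.1 i) - \sum_i c (u.2 i)).
have lam_gam u : lam u = 0 -> cos (gam u) = 1.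
  pose nu j : int := #|[pred i | u.1 i == j]|%:Z - #|[pred i | u.2 i == j]|%:Z.
  have sumE (x : I -> R) :
      \sum_i x (u.1 i) - \sum_i x (u.2 i) = \sum_j x j * (nu j)%:~R.
    rewrite !sum_word -sumrB; apply: eq_bigr => j _.
    by rewrite -mulrBr /nu rmorphB/=.
  by rewrite /lam /gam cosN !sumE; exact: H.
have le_Bp t : \sum_u cos (lam u * t + gam u) <= B ^+ p.
  have -> : \sum_u cos (lam u * t + gam u) = F t ^+ p.
    rewrite sqr_trig_sumX sqr_trig_sumE; apply: eq_bigr => u _; congr cos.
    by rewrite !sumrB -!mulr_suml /lam /gam; ring.
  by rewrite lerXn2r ?nnegrE ?FB// addr_ge0 ?sqr_ge0.
have cntP (w : W) j : (#|[pred i | w i == j]| < p.+1)%N.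
  by rewrite ltnS -[leqRHS]card_ord max_card.
pose cnt (w : W) : {ffun I -> 'I_p.+1} := [ffun j => Ordinal (cntP w j)].
have := card_zero_freq_le lam_gam le_Bp.
rewrite -(ler_pM2l (_ : 0 < p.+1%:R ^+ #|I|)) ?exprn_gt0//.
apply: le_trans; rewrite -exprM mulnC exprM -!natrX -natrM ler_nat.
have := cauchy_schwarz_fibers cnt; rewrite !card_ffun !card_ord.
move=> /leq_trans; apply; rewrite leq_mul2l; apply/orP; right.
apply: subset_leq_card; apply/fintype.subsetP => u.
rewrite !inE => /eqP/ffunP cu.
rewrite /lam !sum_word subr_eq0; apply/eqP; apply: eq_bigr => j _.
by have := cu j; rewrite !ffunE => /(congr1 val)/= ->.
Qed.

(** [F t] is the sum over all pairs [(i, j)] of the cosines below: if it nearly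
    reaches [#|I|^2], none of them can be far from 1. *)
Lemma kronecker_pairs e : 0 < e ->
  exists t, forall i j, cos ((a i * t - c i) - (a j * t - c j)) > 1 - e.
Proof.
move=> e0; have [t Ft] : exists t, #|I|%:R ^+ 2 - e < F t.
  apply: contrapT => noF.
  have : #|I|%:R ^+ 2 <= #|I|%:R ^+ 2 - e :> R.
    apply: card_le_sup_trig => t; rewrite leNgt; apply/negP => Ft.
    by apply: noF; exists t.
  by rewrite lerBrDl gerDr leNgt e0.
exists t => i j; move: Ft; rewrite /F sqr_trig_sumE (bigD1 (i, j))//=.
set S := \sum_(_ | _) _.
have : S <= #|I|%:R ^+ 2 - 1.
  apply: (@le_trans _ _ (\sum_(u : I * I | u != (i, j)) 1)).
    by apply: ler_sum => u _; exact: cos_le1.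
  have : \sum_(u : I * I) (1 : R) = 1 + \sum_(u : I * I | u != (i, j)) 1.
    by rewrite (bigD1 (i, j)).
  rewrite sumr_const card_prod natrM => E.
  by rewrite expr2 E addrC addKr.
by lra.
Qed.

End kronecker.

(** The additional index [None], of frequency and phase zero, turns the agreement
    of all phases with each other into their agreement with 0. *)
Lemma kronecker_approximation (R : realType) (n : nat) (a c : 'I_n -> R) (e : R) :
    0 < e ->
    (forall nu : 'I_n -> int, \sum_i a i * (nu i)%:~R = 0 ->
      cos (\sum_i c i * (nu i)%:~R) = 1) ->
  exists t, forall i, cos (a i * t - c i) > 1 - e.
Proof.
move=> e0 H.
pose ext (x : 'I_n -> R) (i : option 'I_n) := if i is Some j then x j else 0.
have sum_ext x (nu : option 'I_n -> int) :
    \sum_i ext x i * (nu i)%:~R = \sum_i x i * (nu (Some i))%:~R.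
  rewrite [LHS](bigD1 None)//= mul0r add0r.
  rewrite (reindex_omap Some id)/=; last by case.
  by apply: eq_bigl => i; rewrite eqxx.
have [|t Ht] := @kronecker_pairs R (option 'I_n) (ext a) (ext c) _ e e0.
  by move=> nu; rewrite !sum_ext; exact: H.
by exists t => i; have := Ht (Some i) None; rewrite /= mul0r !subr0.
Qed.

(** * The circle as a topological group *)

Section circle_topology.
Variable R : realType.

Let rho : R -> circle R := \pi_(circle R).

Lemma circle_pi_period (x : R) (k : int) :
  \pi_(circle R) (x + k%:~R * (2 * pi)) = \pi_(circle R) x.
Proof. by apply/eq_circle; exists k; rewrite addrAC subrr add0r. Qed.

Lemma circle_pi_zmod_morphism : zmod_morphism (\pi_(circle R) : R -> circle R).
Proof.
move=> x y; rewrite -{2}[x](subrK y) [X in _ = X - _]circle_piD.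
by rewrite addrK.
Qed.

Lemma circle_pi0 : \pi_(circle R) 0 = 0.
Proof. by rewrite -(subrr (0 : R)) circle_pi_zmod_morphism subrr. Qed.

Lemma cos_circle (x y : R) :
  \pi_(circle R) x = \pi_(circle R) y -> cos x = cos y.
Proof.
have per n (z : R) : cos (z + n%:R * (2 * pi)) = cos z.
  by rewrite !mulr_natl periodicn//; exact: cosD2pi.
move=> /eq_circle[[n|n] xy]; first by rewrite -(per n y) -xy addrC subrK.
by rewrite -(per n.+1 x); congr cos; move: xy; rewrite NegzE mulrNz; lra.
Qed.

Lemma circle_repr_itv (x : R) :
  exists2 y, - pi <= y <= pi & \pi_(circle R) y = \pi_(circle R) x.
Proof.
have pi0 : 0 < 2 * pi :> R by rewrite mulr_gt0 ?pi_gt0.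
pose k := Num.floor ((x + pi) / (2 * pi)).
have := floor_itv ((x + pi) / (2 * pi)); rewrite -/k intrD.
rewrite ler_pdivlMr// ltr_pdivrMr// mulrDl mul1r => /andP[k1 k2].
exists (x + (- k)%:~R * (2 * pi)); last exact: circle_pi_period.
by rewrite mulrNz mulNr; apply/andP; split; lra.
Qed.

(** The cosine detects neighbourhoods of zero in the circle. *)
Lemma circle_pi_near0 (d : R) : 0 < d -> exists2 e : R, 0 < e &
  forall x, 1 - e < cos x ->
    exists2 y, `|y| < d & \pi_(circle R) y = \pi_(circle R) x.
Proof.
move=> d0; pose d' := Num.min d pi.
have d'0 : 0 < d' by rewrite lt_min d0 pi_gt0.
have d'I : d' \in `[0, pi] by rewrite in_itv/= ltW//= ge_min lexx orbT.
have z0 : 0 \in `[0, pi : R] by rewrite in_itv/= lexx pi_ge0.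
exists (1 - cos d').
  by rewrite subr_gt0 -cos0 ltr_cos.
move=> x; rewrite opprB addrC subrK.
have [y yI yx] := circle_repr_itv x; rewrite -(cos_circle yx) => cy.
exists y => //; apply: (@lt_le_trans _ _ d'); last by rewrite ge_min lexx.
rewrite -ltr_cos//; last by rewrite in_itv/= normr_ge0 ler_norml.
by have [_|_] := ger0P y; rewrite ?cosN.
Qed.

Lemma circle_pi_eq0 (x : R) : cos x = 1 -> \pi_(circle R) x = 0.
Proof.
have [y yI yx] := circle_repr_itv x; rewrite -yx -(cos_circle yx) => cy.
suff /eqP : `|y| = 0 by rewrite normr_eq0 => /eqP ->; exact: circle_pi0.
apply: cos_inj; rewrite ?in_itv/= ?normr_ge0 ?ler_norml ?lexx ?pi_ge0//.
by rewrite cos0 -cy; have [_|_] := ger0P y; rewrite ?cosN.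
Qed.

(** The preimage of the image of [V] is the union of the translates of [V] by the
    multiples of [2 pi]. *)
Lemma circle_pi_open (V : set R) : open V ->
  open ((\pi_(circle R) : R -> circle R) @` V).
Proof.
move=> oV; change (open (rho @^-1` (rho @` V))).
rewrite openE => z [v Vv] /eq_circle[k vz].
have cs : continuous (fun s : R => s + k%:~R * (2 * pi)).
  by move=> s; apply: cvgD; [exact: cvg_id|exact: cvg_cst].
have : nbhs z ((fun s : R => s + k%:~R * (2 * pi)) @^-1` V).
  apply: cs; apply: open_nbhs_nbhs; split=> //.
  by rewrite -vz addrC subrK.
apply: filterS => s /= Vs; exists (s + k%:~R * (2 * pi)) => //.
exact: circle_pi_period.
Qed.

(** A product of quotient maps need not be a quotient map, but here the projection
    is open, so that the continuity of subtraction descends from the line. *)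
Lemma circle_sub_continuous :
  continuous (fun x : circle R * circle R => x.1 - x.2).
Proof.
move=> [a b] /= U; rewrite -[a]reprK -[b]reprK -circle_pi_zmod_morphism.
set x := repr a; set y := repr b => /circle_pi_continuous.
move=> /nbhs_ballP[e /= e0 eU].
have nb (z : R) : nbhs (rho z) (rho @` ball z (e / 2)).
  apply: open_nbhs_nbhs; split; first exact/circle_pi_open/ball_open.
  by exists z => //; apply: ballxx; rewrite divr_gt0.
exists (rho @` ball x (e / 2), rho @` ball y (e / 2)); first by split; exact: nb.
move=> [_ _] /= [[s xs <-] [t yt <-]]; rewrite /rho -circle_pi_zmod_morphism.
apply: eU; rewrite /ball/= in xs yt *.
rewrite (_ : _ - _ = (x - s) - (y - t)); last by ring.
by rewrite (le_lt_trans (ler_normB _ _))// [e]splitr ltrD.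
Qed.

(** The cosine descends to a continuous function equal to 1 at 0 only. *)
Lemma circle_closed0 : closed [set (0 : circle R)].
Proof.
have cr : continuous (cos \o repr : circle R -> R).
  apply: repr_comp_continuous; first exact: continuous_cos.
  by move=> x y /eqP xy; apply/eqP; exact: cos_circle.
have -> : [set 0] = (cos \o repr : circle R -> R) @^-1` [set 1].
  apply/seteqP; split => [_ ->|x /= /circle_pi_eq0]; last by rewrite reprK.
  by rewrite /= -[RHS]cos0; apply: cos_circle; rewrite reprK circle_pi0.
by apply: (continuous_closedP _).1 => //; exact: closed_eq.
Qed.

End circle_topology.

Section circle_valued_functions.
Variables (R : realType) (X : topologicalType).
Implicit Types f g : X -> circle R.

Lemma continuous_circleB f g : continuous f -> continuous g ->
  continuous (fun x => f x - g x).
Proof.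
move=> cf cg x.
apply: (@continuous_comp _ _ _ (fun x => (f x, g x))
  (fun p : circle R * circle R => p.1 - p.2)).
  exact: (cvg_pair (cf x) (cg x)).
exact: circle_sub_continuous.
Qed.

Lemma continuous_circleN f : continuous f -> continuous (fun x => - f x).
Proof.
by move=> cf; under eq_fun do rewrite -sub0r; apply: continuous_circleB => // x;
  exact: cvg_cst.
Qed.

Lemma continuous_circleD f g : continuous f -> continuous g ->
  continuous (fun x => f x + g x).
Proof.
move=> cf cg; under eq_fun do rewrite -[g _]opprK.
by apply: continuous_circleB => //; exact: continuous_circleN.
Qed.

Lemma continuous_circleMn f k : continuous f -> continuous (fun x => f x *+ k).
Proof.
move=> cf; elim: k => [|k IH]; first by move=> x; exact: cvg_cst.
by under eq_fun do rewrite mulrS; exact: continuous_circleD.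
Qed.

Lemma continuous_circle_combination n (F : nat -> X -> circle R)
    (nu : nat -> int) : (forall j, continuous (F j)) ->
  continuous (fun x => \sum_(j < n) F j x *~ nu j).
Proof.
move=> cF; elim: n => [|n IH].
  by under eq_fun do rewrite big_ord0; move=> x; exact: cvg_cst.
under eq_fun do rewrite big_ord_recr/=.
apply: continuous_circleD => //; case: (nu n) => k.
  exact: (continuous_circleMn (f := F n)).
under eq_fun do rewrite NegzE mulrNz.
exact/continuous_circleN/(continuous_circleMn (f := F n)).
Qed.

End circle_valued_functions.

(** * Integral combinations of the frequencies *)

Lemma zmod_morphism_combination (U V : zmodType) (f : U -> V) (I : finType)
    (x : I -> U) (nu : I -> int) : zmod_morphism f ->
  f (\sum_i x i *~ nu i) = \sum_i f (x i) *~ nu i.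
Proof.
move=> fB; pose fA : {additive U -> V} :=
  HB.pack f (GRing.isZmodMorphism.Build U V f fB).
by rewrite -[f]/(fA : U -> V) raddf_sum; apply: eq_bigr => i _; rewrite raddfMz.
Qed.

(** Padding with zero coefficients brings combinations to a common length, where
    they can be subtracted. *)
Lemma combination_widen (V : zmodType) (x : nat -> V) (nu : nat -> int) n N :
  (n <= N)%N ->
  \sum_(j < n) x j *~ nu j = \sum_(j < N) x j *~ (if (j < n)%N then nu j else 0).
Proof.
move=> nN; rewrite (big_ord_widen N (fun j => x j *~ nu j))// big_mkcond/=.
by apply: eq_bigr => j _; case: ifP.
Qed.

Lemma combination_delta (V : zmodType) (x : nat -> V) j :
  \sum_(i < j.+1) x i *~ (i == j :> nat)%:Z = x j.
Proof.
rewrite big_ord_recr/= eqxx big1 ?add0r// => i _.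
by rewrite ltn_eqF.
Qed.

Section frequency_module.
Variables (R : realType) (omega : nat -> R).

Lemma frequency_in j : omega j \in in_frequency_module omega.
Proof.
apply/in_frequency_moduleP; exists (fun i => (i == j)%:Z); split.
  apply: (sub_finite_set _ (finite_set1 j)) => i /=.
  by have [->|_] := eqVneq i j; rewrite ?eqxx.
rewrite -(fsbig_widen [set j])//= ?fsbig_set1 ?eqxx ?mulr1//.
by move=> i [_ /= /eqP/negPf ->]; rewrite mulr0.
Qed.

Definition frequency j : frequency_module omega :=
  exist (fun x : R => x \in in_frequency_module omega) (omega j)
    (frequency_in j).

Lemma val_frequency_combination (I : finType) (f : I -> nat) (nu : I -> int) :
  val (\sum_i frequency (f i) *~ nu i) = \sum_i omega (f i) * (nu i)%:~R.
Proof.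
rewrite (@zmod_morphism_combination _ _ val); last first.
  by move=> x y; rewrite raddfB.
by apply: eq_bigr => i _; rewrite mulrzr.
Qed.

Lemma frequency_module_combination (m : frequency_module omega) :
  exists n (nu : nat -> int), m = \sum_(j < n) frequency j *~ nu j.
Proof.
have /in_frequency_moduleP[nu [fnu mE]] := valP m.
have [n nuS] : exists n, [set j | nu j != 0] `<=` `I_n.
  have [s sE] := (finite_seqP _).1 fnu; exists (\max_(i <- s) i).+1 => j.
  rewrite sE/= => js; rewrite ltnS.
  exact: (@leq_bigmax_seq _ s xpredT id).
exists n, nu; apply: val_inj; rewrite mE.
rewrite (val_frequency_combination (fun j : 'I_n => j)) -(fsbig_widen `I_n)//=.
  by rewrite -fsbig_ord.
move=> j [_ /= jn]; have [->|/nuS//] := eqVneq (nu j) 0.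
by rewrite mulr0.
Qed.

End frequency_module.

(** * The closure of an orbit and the dual of the frequency module *)

Lemma pointwise_cvg (T : Type) (V : topologicalType)
    (F : set_system {ptws T -> V}) (f : {ptws T -> V}) : Filter F ->
  (forall t, (fun g : {ptws T -> V} => g t) @ F --> f t) -> F --> f.
Proof.
move=> FF Ff; apply/cvg_sup => t U [_ /= [[W oW <-]] Wft /filterS]; apply.
by apply: Ff; exact: open_nbhs_nbhs.
Qed.

Section orbit_closure.
Variables (R : realType) (omega : nat -> R) (theta : infinite_torus R).
Let orbit_closure := closure (kronecker_orbit omega theta).
Let module := discrete_topology (frequency_module omega).
Let dual := pontryagin_dual R module.

Definition displacement (z : infinite_torus R) (j : nat) : circle R :=
  z j - theta j.

(** The points satisfying a given relation form a closed set, and those of the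
    orbit satisfy it because their displacements are the [omega_j t]. *)
Lemma orbit_closure_relation (z : infinite_torus R) n (nu : nat -> int) :
  orbit_closure z -> \sum_(j < n) frequency omega j *~ nu j = 0 ->
  \sum_(j < n) displacement z j *~ nu j = 0.
Proof.
move=> Xz /(congr1 val); rewrite val_frequency_combination /= => nu0.
pose S (y : infinite_torus R) := \sum_(j < n) displacement y j *~ nu j.
have cS : continuous S.
  apply: (@continuous_circle_combination R (infinite_torus R) n
    (fun j y => displacement y j) nu) => j.
  apply: (@continuous_circleB R (infinite_torus R) (fun y => y j)
    (fun=> theta j)).
    exact: (@proj_continuous nat (fun=> circle R) j).
  exact: (@cst_continuous (infinite_torus R) (circle R) (theta j)).
have cl : closed (S @^-1` [set 0]).
  by apply: (continuous_closedP _).1 => //; exact: circle_closed0.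
have : closure (S @^-1` [set 0]) z.
  apply: closure_subset Xz => _ [t _ <-]; rewrite /= /S.
  have flowE j : displacement (kronecker_flow omega t theta) j =
      \pi_(circle R) (omega j * t).
    by rewrite /displacement /kronecker_flow circle_piD reprK addrC addKr.
  under eq_bigr do rewrite flowE.
  rewrite -(zmod_morphism_combination (fun j : 'I_n => omega j * t)
    (fun j : 'I_n => nu j) (@circle_pi_zmod_morphism R)).
  rewrite -[RHS]circle_pi0; congr (\pi_(circle R) _).
  rewrite (eq_bigr (fun j : 'I_n => omega j * (nu j)%:~R * t)).
    by rewrite -mulr_suml nu0 mul0r.
  by move=> j _; rewrite -mulrzr mulrAC.
by move/cl.
Qed.

Let coordinates_exist (m : module) : exists nnu : nat * (nat -> int),
  m = \sum_(j < nnu.1) frequency omega j *~ nnu.2 j.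
Proof.
have [n [nu mE]] := frequency_module_combination m.
by exists (n, nu).
Qed.

(** When the frequencies are dependent these coefficients are not unique; some are
    chosen, and [character_ofE] shows that the choice is immaterial. *)
Definition coordinates (m : module) := sval (cid (coordinates_exist m)).

Lemma coordinatesE m :
  m = \sum_(j < (coordinates m).1) frequency omega j *~ (coordinates m).2 j.
Proof. exact: (svalP (cid (coordinates_exist m))). Qed.

Definition character_of (z : infinite_torus R) :
    {compact-open, module -> circle R} :=
  fun m => \sum_(j < (coordinates m).1) displacement z j *~ (coordinates m).2 j.

(** Two expansions of the same element differ by a relation between the
    frequencies, which the displacements of [z] satisfy as well. *)
Lemma character_ofE (z : infinite_torus R) n (nu : nat -> int) :
  orbit_closure z ->
  character_of z (\sum_(j < n) frequency omega j *~ nu j) =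
  \sum_(j < n) displacement z j *~ nu j.
Proof.
move=> Xz; set m := \sum_(j < n) _; have := coordinatesE m.
rewrite /character_of; move: (coordinates m) => [k mu]/= /esym mE.
have nN := leq_maxl k n; have kN := leq_maxr k n.
move: mE; rewrite /m.
rewrite (combination_widen _ _ nN) (combination_widen _ _ kN).
rewrite (combination_widen _ mu nN) (combination_widen _ nu kN).
move=> /eqP; rewrite -subr_eq0 -sumrB => /eqP E.
apply/eqP; rewrite -subr_eq0 -sumrB; apply/eqP.
under eq_bigr do rewrite -mulrzBr.
apply: (@orbit_closure_relation z _ (fun j => (if (j < k)%N then mu j else 0) -
  (if (j < n)%N then nu j else 0))) => //.
by rewrite -[RHS]E; apply: eq_bigr => j _; rewrite mulrzBr.
Qed.

Lemma character_of_dual (z : infinite_torus R) :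
  orbit_closure z -> dual (character_of z).
Proof.
move=> Xz; split.
  move=> m U /nbhs_singleton Um.
  by rewrite /= nbhs_principalE; apply/principal_filterP.
move=> x y.
rewrite {1}(coordinatesE x) {1}(coordinatesE y) /character_of.
move: (coordinates x) (coordinates y) => [n nu] [k mu]/=.
have nN := leq_maxl n k; have kN := leq_maxr n k.
rewrite -/(character_of z _).
rewrite !(combination_widen _ nu nN) !(combination_widen _ mu kN) -!sumrB.
under eq_bigr do rewrite -mulrzBr.
under [RHS]eq_bigr do rewrite -mulrzBr.
exact: (@character_ofE z _ (fun j => (if (j < n)%N then nu j else 0) -
  (if (j < k)%N then mu j else 0))).
Qed.

Definition point_of (chi : {compact-open, module -> circle R}) :
    infinite_torus R :=
  fun j => theta j + chi (frequency omega j).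

Lemma character_ofK (z : infinite_torus R) :
  orbit_closure z -> point_of (character_of z) = z.
Proof.
move=> Xz; apply/funext => j; rewrite /point_of.
rewrite -[in X in character_of z X](combination_delta (frequency omega) j).
rewrite (@character_ofE z j.+1 (fun i => (i == j)%:Z))//.
by rewrite (combination_delta (displacement z)) addrC subrK.
Qed.

Lemma point_ofK (chi : {compact-open, module -> circle R}) :
  dual chi -> character_of (point_of chi) = chi.
Proof.
move=> [_ chiB]; apply/funext => m.
rewrite /character_of [in RHS](coordinatesE m).
rewrite (zmod_morphism_combination _ _ chiB); apply: eq_bigr => j _.
by rewrite /displacement /point_of addrC addKr.
Qed.

(** A character satisfies the hypothesis of Kronecker's theorem, being a morphism on
    the module generated by the [omega_j].  Approximating the first [n]
    coordinates with an error tending to 0 as [n] grows gives a sequence of points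
    of the orbit which converges pointwise. *)
Lemma point_of_closure (chi : {compact-open, module -> circle R}) :
  dual chi -> orbit_closure (point_of chi).
Proof.
move=> [_ chiB]; pose c j := repr (chi (frequency omega j)).
have approx n : exists t, forall i : 'I_n,
    1 - n.+1%:R^-1 < cos (omega i * t - c i).
  apply: (@kronecker_approximation R n (fun i => omega i) (fun i => c i))
    => [|nu nu0].
    by rewrite invr_gt0.
  rewrite -[RHS]cos0; apply: cos_circle; rewrite circle_pi0.
  under eq_bigr do rewrite mulrzr.
  rewrite (zmod_morphism_combination _ _ (@circle_pi_zmod_morphism R)).
  under eq_bigr do rewrite reprK.
  rewrite -(zmod_morphism_combination _ _ chiB).
  have -> : \sum_(i < n) frequency omega i *~ nu i = 0.
    by apply: val_inj; rewrite val_frequency_combination.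
  by rewrite -(subrr 0) chiB subrr.
have [t tP] := choice approx.
have cvgt :
    (fun n => kronecker_flow omega (t n) theta) @ \oo --> point_of chi.
  apply: pointwise_cvg => j U; rewrite /point_of -[theta j]reprK -[chi _]reprK.
  rewrite -circle_piD => /circle_pi_continuous /nbhs_ballP[d /= d0 dU].
  have [e e0 eP] := circle_pi_near0 d0.
  change (\forall n \near \oo, U (kronecker_flow omega (t n) theta j)).
  near=> n; rewrite /kronecker_flow.
  have jn : (j < n)%N by near: n; exists j.+1.
  have [|y yd yE] := eP (omega j * t n - c j).
    apply: lt_trans (tP n (Ordinal jn)); rewrite ltrD2l ltrN2.
    near: n; exact: near_infty_natSinv_lt (PosNum e0).
  have -> : \pi_(circle R) (repr (theta j) + omega j * t n) =
      \pi_(circle R) (repr (theta j) + c j + y).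
    rewrite circle_piD [RHS]circle_piD yE -!circle_piD.
    by congr (\pi_(circle R) _); ring.
  by apply: dU; rewrite /ball/= opprD addrA subrr sub0r normrN.
move=> B /cvgt /= [N _ NB]; exists (kronecker_flow omega (t N) theta); split.
  by exists (t N).
exact: NB (leqnn N).
Unshelve. all: by end_near. Qed.

Lemma orbit_closure_homeomorphic_dual :
  homeomorphic (set_type orbit_closure) (set_type dual).
Proof.
pose f (z : set_type orbit_closure) : set_type dual :=
  exist _ (character_of (val z)) (mem_set (character_of_dual (set_valP z))).
pose g (chi : set_type dual) : set_type orbit_closure :=
  exist _ (point_of (val chi)) (mem_set (point_of_closure (set_valP chi))).
have val_continuous (A : topologicalType) (B : set A) :
    continuous (val : set_type B -> A) by exact: initial_continuous.
have eval_continuous m : continuous (fun z : set_type orbit_closure =>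
    character_of (val z) m).
  apply: (@continuous_circle_combination R (set_type orbit_closure) _
    (fun j z => displacement (val z) j)) => j.
  apply: continuous_circleB; last exact: cst_continuous.
  move=> z; exact: (continuous_comp (val_continuous _ orbit_closure z)
    (@proj_continuous nat (fun=> circle R) j (val z))).
exists f, g; split.
- apply: continuous_comp_initial => z.
  have FF := fmap_filter (set_val \o f) (nbhs_filter z).
  apply: (compact_open_cvgP _ FF).2 => K O cK oO KO.
  change (nbhs z [set x | character_of (val x) @` K `<=` O]).
  (* As points are open in the discrete module, [near_covering] reduces the
     uniform control on K to the continuity of evaluation at a point. *)
  have /compact_near_coveringP cov := cK.
  have : nbhs z [set x | K `<=` [set m | O (character_of (val x) m)]].
    apply: (cov _ (nbhs z) (fun x m => O (character_of (val x) m))) => m Km.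
    exists ([set m], [set x | O (character_of (val x) m)]); last first.
      by move=> [_ x] /= [->].
    split; first exact: discrete_set1.
    apply: eval_continuous; apply: open_nbhs_nbhs; split => //.
    by apply: KO; exists m.
  by apply: filterS => x KxO _ [m Km <-]; exact: KxO.
- apply: continuous_comp_initial => chi.
  have FF := fmap_filter (set_val \o g) (nbhs_filter chi).
  apply: (pointwise_cvg FF) => j.
  apply: (@continuous_circleD R (set_type dual) (fun=> theta j)
    (fun chi => val chi (frequency omega j))).
    exact: cst_continuous.
  move=> xi U; rewrite nbhsE => -[W [oW Wxi] WU].
  have KO : open ([set h | h @` [set frequency omega j] `<=` W] :
      set {compact-open, module -> circle R}).
    by apply: compact_open_open => //; exact: compact_set1.
  have : nbhs (val xi) [set h | h @` [set frequency omega j] `<=` W].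
    by apply: open_nbhs_nbhs; split => // _ [_ -> <-].
  move=> /(val_continuous _ dual xi) nW.
  change (nbhs xi [set h : set_type dual | U (val h (frequency omega j))]).
  apply: (@filterS _ _ (nbhs_filter xi) _ _ _ nW) => h /= hW.
  by apply/WU/hW; exists (frequency omega j).
- by move=> z; apply: val_inj; rewrite /= character_ofK//; exact: set_valP.
- by move=> chi; apply: val_inj; rewrite /= point_ofK//; exact: set_valP.
Qed.

End orbit_closure.

Theorem proposition4p25 (R : realType) (omega : nat -> R)
    (theta : infinite_torus R) :
  homeomorphic
    (set_type (closure (kronecker_orbit omega theta)))
    (set_type (pontryagin_dual R (discrete_topology (frequency_module omega)))).
Proof. exact: orbit_closure_homeomorphic_dual. Qed.
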